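(* Let $\mathcal{A}$ be a complex Banach algebra with unity, $k$ a positive integer, and let $a,b\in\mathcal{A}$ both be g$\pi$-Hirano invertible. Suppose $ab\alpha_{1}\cdots\alpha_{k}=ba\alpha_{1}\cdots\alpha_{k}$ for all $\alpha_{1},\dots,\alpha_{k}\in\{a,b\}$. Then $1+a^{g\pi H}b$ is g$\pi$-Hirano invertible if and only if $a+b$ is g$\pi$-Hirano invertible.
   Context: $\mathcal{A}^{qnil}$ denotes the set of quasinilpotent elements of $\mathcal{A}$ (spectrum equal to $\{0\}$). An element $x\in\mathcal{A}$ is a g$\pi$-Hirano inverse of $a$ if $xax=x$, $ax=xa$ and $a-a^{n+2}x\in\mathcal{A}^{qnil}$ for some positive integer $n$; it is unique when it exists and is denoted $a^{g\pi H}$, and $a$ is then called g$\pi$-Hirano invertible. *)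

(* Defs.v *)
From HB Require Import structures.
From mathcomp Require Import all_boot all_order all_algebra.
From mathcomp Require Import all_classical all_reals.
From mathcomp Require Export complex.
Set Implicit Arguments. Unset Strict Implicit. Unset Printing Implicit Defensive.
Import Order.TTheory GRing.Theory Num.Theory.
Local Open Scope classical_set_scope.
Local Open Scope ring_scope.
Local Open Scope complex_scope.

Section Defs.
Context {R : realType} {A : algType R[i]}.

Definition banach_algebra_norm (N : A -> R) : Prop :=
  [/\ forall x : A, N x = 0 <-> x = 0,
      forall (c : R[i]) (x : A), (N (c *: x))%:C = `|c| * (N x)%:C,
      forall x y : A, N (x + y) <= N x + N y,
      forall x y : A, N (x * y) <= N x * N y &
      forall u : nat -> A,
        (forall e : R, 0 < e -> exists M : nat, forall m n : nat,
            (M <= m)%N -> (M <= n)%N -> N (u m - u n) < e) ->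
        exists l : A, forall e : R, 0 < e -> exists M : nat, forall n : nat,
            (M <= n)%N -> N (u n - l) < e].

Definition invertible (x : A) : Prop := exists y : A, x * y = 1 /\ y * x = 1.

Definition spectrum (a : A) : set R[i] := [set l | ~ invertible (l%:A - a)].

Definition quasinilpotent (a : A) : Prop := spectrum a = [set 0].

Definition is_gpiH_inverse (a x : A) : Prop :=
  [/\ x * a * x = x, a * x = x * a &
      exists n : nat, (0 < n)%N /\ quasinilpotent (a - a ^+ n.+2 * x)].

Definition gpiH_invertible (a : A) : Prop := exists x : A, is_gpiH_inverse a x.

End Defs.

(* Main.v *)
Require Import Defs.
From HB Require Import structures.
From mathcomp Require Import all_boot all_order all_algebra.
From mathcomp Require Import all_classical all_reals.
From mathcomp Require Import complex.
From mathcomp Require Import topology normedtype.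
From mathcomp Require Import ring lra.
Import Order.TTheory GRing.Theory Num.Theory.
Import numFieldNormedType.Exports.
Local Open Scope ring_scope.
Local Open Scope complex_scope.

(* Call [z] topologically nilpotent ([tnil]) when [N (z ^+ n) = O(e ^+ n)] for every
   [e > 0]. By the spectral radius formula this is quasinilpotency, and [z] is gpi-Hirano
   invertible iff [z - z ^+ m.+2] is topologically nilpotent for some [m]; one direction
   lifts the approximate idempotent [z ^+ m.+1] to an idempotent commuting with [z].

   Let [X] be the right ideal of all [v] with [(a b - b a) w v = 0] for every word [w] in
   [a], [b]. It contains the long words and the inverse [g] of [a], and is stable under
   left multiplication by [a], [b], [g], which commute pairwise on [X]. Modulo the elements
   that are topologically nilpotent on [X], the algebra generated by [a], [b], [g] is
   commutative, [a] and [b] satisfy [x ^+ m.+2 = x] for some [m], and [g] is the group inverse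
   of [a]; there the statement is elementary. It is carried back to the algebra because
   [(z ^+ m.+2 - z) ^+ k] lies in [X] for [z = a + b] and for [z = 1 + g b]. *)

(** Compactness of the square in its near-covering form, with the filter of large [M] as parameter,
    merges the local bounds into one. It is applied to the norm of a resolvent. *)
Lemma locally_bounded_square (R : realType) (g : R -> R -> R) (r : R) :
  (forall x y, exists2 d : R, 0 < d & exists M : R, forall x' y',
     `|x' - x| < d -> `|y' - y| < d -> g x' y' <= M) ->
  exists M : R, forall x y, `|x| <= r -> `|y| <= r -> g x y <= M.
Proof.
move=> loc; have cpt := compact_setX (@segment_compact R (- r) r) (@segment_compact R (- r) r).
have /compact_near_coveringP /(_ R (pinfty_nbhs R) (fun M z => g z.1 z.2 <= M) _) := cpt.
case=> [[x y] _|M [_ hM]].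
  have [d d0 [M hM]] := loc x y.
  exists (ball (x, y) d, [set M' | M < M'])%classic => /=.
    by split; [exact: nbhsx_ballx | exists M; split=> //; exact: num_real].
  move=> [[x' y'] M'] /= [[/= bx by_] MM']; apply: le_trans (hM _ _ _ _) (ltW MM').
    by rewrite distrC.
  by rewrite distrC.
exists (M + 1) => x y xr yr; apply: (hM (M + 1) _ (x, y)); first by lra.
by rewrite /= !in_itv /= -!ler_norml.
Qed.

(** * Potent elements modulo an ideal with commutative quotient *)

Section PotentModulo.
Variables (K : nzRingType) (S J : K -> Prop).
Hypotheses (S1 : S 1) (SD : forall x y, S x -> S y -> S (x + y))
  (SN : forall x, S x -> S (- x)) (SM : forall x y, S x -> S y -> S (x * y)).
Hypotheses (J0 : J 0) (JD : forall x y, S x -> S y -> J x -> J y -> J (x + y))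
  (JM : forall x y, S x -> S y -> J y -> J (x * y))
  (JC : forall x y, S x -> S y -> J (x * y - y * x)).

(** Membership in [S] is carried along because [J] absorbs products, and contains commutators, only
    within [S]. *)
Definition congruent x y := [/\ S x, S y & J (x - y)].
Local Notation "x ~~ y" := (congruent x y) (at level 70).

Definition potent x := exists m, x ^+ m.+2 ~~ x.

Lemma closedB x y : S x -> S y -> S (x - y).
Proof. by move=> Sx Sy; apply: SD => //; exact: SN. Qed.

Lemma closedX x n : S x -> S (x ^+ n).
Proof. by move=> Sx; elim: n => [|n IH]; rewrite ?expr0 ?exprS //; exact: SM. Qed.

Lemma closed0 : S 0.
Proof. by rewrite -(subrr 1); exact: closedB. Qed.

Lemma cgxx x : S x -> x ~~ x.
Proof. by move=> Sx; split=> //; rewrite subrr. Qed.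

Lemma cg_sym x y : x ~~ y -> y ~~ x.
Proof.
case=> Sx Sy h; split=> //; rewrite -opprB -mulN1r.
by apply: JM => //; [exact: SN | exact: closedB].
Qed.

Lemma cg_trans y x z : x ~~ y -> y ~~ z -> x ~~ z.
Proof.
case=> Sx Sy h [_ Sz h']; split=> //; rewrite -(subrK y x) -addrA.
by apply: JD => //; exact: closedB.
Qed.

Lemma cgD x x' y y' : x ~~ x' -> y ~~ y' -> x + y ~~ x' + y'.
Proof.
case=> Sx Sx' h [Sy Sy' h']; split; try exact: SD.
by rewrite opprD addrACA; apply: JD => //; exact: closedB.
Qed.

Lemma cgC x y : S x -> S y -> x * y ~~ y * x.
Proof. by move=> Sx Sy; split; [exact: SM | exact: SM | exact: JC]. Qed.

Lemma cgMl x y y' : S x -> y ~~ y' -> x * y ~~ x * y'.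
Proof.
move=> Sx [Sy Sy' h]; split; try exact: SM.
by rewrite -mulrBr; apply: JM => //; exact: closedB.
Qed.

Lemma cgN x y : x ~~ y -> - x ~~ - y.
Proof. by move=> e; rewrite -(mulN1r x) -(mulN1r y); apply: cgMl => //; exact: SN. Qed.

Lemma cgMr x x' y : S y -> x ~~ x' -> x * y ~~ x' * y.
Proof.
move=> Sy e; have [Sx Sx' _] := e.
apply: (cg_trans (y * x)); first exact: cgC.
by apply: cg_trans (cgC _ _ Sy Sx'); exact: cgMl.
Qed.

Lemma cgM x x' y y' : x ~~ x' -> y ~~ y' -> x * y ~~ x' * y'.
Proof.
move=> ex ey; have [_ Sx' _] := ex; have [Sy _ _] := ey.
by apply: (cg_trans (x' * y)); [exact: cgMr | exact: cgMl].
Qed.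

Lemma cg_exprMn x y n : S x -> S y -> (x * y) ^+ n ~~ x ^+ n * y ^+ n.
Proof.
move=> Sx Sy; elim: n => [|n IH]; first by rewrite !expr0 mulr1; exact: cgxx.
rewrite exprS; apply: (cg_trans (x * y * (x ^+ n * y ^+ n))).
  by apply: cgMl => //; exact: SM.
rewrite (exprS x) (exprS y) !mulrA; apply: cgMr; first exact: closedX.
by rewrite -!mulrA; apply: cgMl => //; apply: cgC => //; exact: closedX.
Qed.

Lemma cg_period x m k : x ^+ m.+2 ~~ x -> x ^+ (m.+1 * k).+1 ~~ x.
Proof.
move=> e; have [_ Sx _] := e; elim: k => [|k IH]; first by rewrite muln0 expr1; exact: cgxx.
rewrite mulnS -addnS exprD; apply: cg_trans e.
by rewrite [x ^+ m.+2]exprSr; apply: cgMl => //; exact: closedX.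
Qed.

Lemma potent_common x y : potent x -> potent y ->
  exists n, x ^+ n.+2 ~~ x /\ y ^+ n.+2 ~~ y.
Proof.
(* The periods [m.+1] and [l.+1] both divide their product, and [n.+2] is that product plus one. *)
move=> [m hm] [l hl]; exists (m.+1 * l.+1).-1; rewrite prednK ?muln_gt0 //.
by split; [exact: cg_period | rewrite mulnC; exact: cg_period].
Qed.

Lemma potent_cg x y : x ~~ y -> potent x -> potent y.
Proof.
move=> e [m hm]; exists m; apply: (cg_trans _ _ _ _ e); apply: cg_trans hm.
elim: m.+2 => [|n IH]; first by rewrite !expr0; exact: cgxx.
by rewrite !exprS; apply: cgM => //; exact: cg_sym.
Qed.

Lemma potentM x y : potent x -> potent y -> potent (x * y).
Proof.
move=> px py; have [n [ex ey]] := potent_common x y px py; exists n.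
have [_ Sx _] := ex; have [_ Sy _] := ey.
by apply: cg_trans (cg_exprMn _ _ _ Sx Sy) _; exact: cgM.
Qed.

Lemma potent_idem x : x * x ~~ x -> potent x.
Proof. by exists 0%N; rewrite expr2. Qed.

Lemma cg_exprDn x y n : S x -> S y -> x * y ~~ 0 ->
  (x + y) ^+ n.+1 ~~ x ^+ n.+1 + y ^+ n.+1.
Proof.
move=> Sx Sy e; elim: n => [|n IH]; first by rewrite !expr1; apply: cgxx; exact: SD.
rewrite exprS; apply: (cg_trans ((x + y) * (x ^+ n.+1 + y ^+ n.+1))).
  by apply: cgMl => //; exact: SD.
have xy0 : x * y ^+ n.+1 ~~ 0.
  by rewrite exprS mulrA -[0](mul0r (y ^+ n)); apply: cgMr => //; exact: closedX.
have yx0 : y * x ^+ n.+1 ~~ 0.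
  rewrite exprS mulrA -[0](mul0r (x ^+ n)); apply: cgMr; first exact: closedX.
  by apply: cg_trans e; exact: cgC.
rewrite mulrDl !mulrDr -!exprS -[X in _ ~~ X + _]addr0 -[y ^+ n.+2 in X in _ ~~ X]add0r.
by apply: cgD; apply: cgD => //; apply: cgxx; exact: closedX.
Qed.

Lemma potentD x y : x * y ~~ 0 -> potent x -> potent y -> potent (x + y).
Proof.
move=> e px py; have [n [ex ey]] := potent_common x y px py; exists n.
have [_ Sx _] := ex; have [_ Sy _] := ey.
by apply: cg_trans (cg_exprDn _ _ _ Sx Sy e) _; exact: cgD.
Qed.

(** * Group inverses modulo [J] *)

Section GroupInverse.
Variables a g : K.
Hypotheses (Sa : S a) (Sg : S g) (aag : a * a * g ~~ a) (gga : g * g * a ~~ g).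

Lemma group_inverse_agg : a * (g * g) ~~ g.
Proof. by apply: cg_trans gga; apply: cgC => //; exact: SM. Qed.

Lemma group_inverse_gag : g * (a * g) ~~ g.
Proof.
by apply: cg_trans gga; rewrite -mulrA; apply: cgMl => //; exact: cgC.
Qed.

Lemma group_inverse_idem : (1 - a * g) * (1 - a * g) ~~ 1 - a * g.
Proof.
have Sp : S (a * g) by exact: SM.
have Sr : S (1 - a * g) by exact: closedB.
split=> //; first exact: SM.
have -> : (1 - a * g) * (1 - a * g) - (1 - a * g) = - (a * g) + a * (g * (a * g)).
  by rewrite mulrBl mul1r addrAC subrr add0r mulrBr mulr1 opprB addrC mulrA.
have [_ _] : - (a * g) + a * (g * (a * g)) ~~ - (a * g) + a * g.
  apply: cgD; first by apply: cgxx; exact: SN.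
  by apply: cgMl => //; exact: group_inverse_gag.
by rewrite addNr subr0.
Qed.

(** Modulo [J], [a ^+ m.+1] fixes [g] because [g] is [a (g g)]. Hence [g] is [a ^+ m.+1 g], and
    [g ^+ m.+2] becomes [g ^+ m.+1 a ^+ m.+1 g], that is [(g a) ^+ m.+1 g], which is [g]. *)
Lemma potent_group_inverse : potent a -> potent g.
Proof.
move=> [m hm]; exists m.
have SaX k : S (a ^+ k) by exact: closedX.
have Sgg : S (g * g) by exact: SM.
have e1 : a ^+ m.+1 * g ~~ g.
  apply: (cg_trans (a ^+ m.+1 * (a * (g * g)))).
    by apply: cgMl => //; apply: cg_sym; exact: group_inverse_agg.
  rewrite mulrA -exprSr; apply: cg_trans group_inverse_agg; exact: cgMr.
have e2 k : (g * a) ^+ k * g ~~ g.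
  elim: k => [|k IH]; first by rewrite expr0 mul1r; exact: cgxx.
  rewrite exprSr -mulrA; apply: cg_trans IH.
  apply: cgMl; first by apply: closedX; exact: SM.
  by rewrite -mulrA; exact: group_inverse_gag.
rewrite exprSr; apply: (cg_trans (g ^+ m.+1 * (a ^+ m.+1 * g))).
  by apply: cgMl; [exact: closedX | exact: cg_sym].
rewrite mulrA; apply: cg_trans (e2 m.+1); apply: cgMr => //.
by apply: cg_sym; exact: cg_exprMn.
Qed.

(* With [p = a g]: [a + b = a (1 + g b) + (1 - p) b] and
   [1 + g b = g (a + b) + (1 - p)] are sums with summands of product [0]. *)
Lemma potentD_group_inverse b : potent a -> potent b ->
  potent (1 + g * b) <-> potent (a + b).
Proof.
move=> pa pb; have [_ [_ Sb _]] := pb.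
have Sp : S (a * g) by exact: SM.
have Sr : S (1 - a * g) by exact: closedB.
have pr := potent_idem _ group_inverse_idem.
split=> [pz | ps].
  have [_ [_ Sz _]] := pz.
  have -> : a + b = a * (1 + g * b) + (1 - a * g) * b.
    by rewrite mulrDr mulr1 mulrBl mul1r mulrA -addrA [_ + (b - _)]addrC subrK.
  apply: potentD; [| exact: potentM | exact: potentM].
  apply: (cg_trans (a * (1 - a * g) * ((1 + g * b) * b))).
    rewrite -!mulrA; apply: cgMl => //; rewrite !mulrA; apply: cgMr => //; exact: cgC.
  rewrite -[0](mul0r ((1 + g * b) * b)); apply: cgMr; first exact: SM.
  rewrite mulrBr mulr1 mulrA -[0](subrr a); apply: cgD; first exact: cgxx.
  exact: cgN.
have [_ [_ Ss _]] := ps.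
have Sgb : S (g * b) by exact: SM.
apply: (@potent_cg (g * (a + b) + (1 - a * g))).
  have -> : g * (a + b) + (1 - a * g) = (g * a - a * g) + (1 + g * b).
    by rewrite mulrDr addrACA [RHS]addrACA [g * b - _]addrC.
  rewrite -[X in _ ~~ X]add0r; apply: cgD; last by apply: cgxx; exact: SD.
  split; [by apply: closedB; exact: SM | exact: closed0 | rewrite subr0; exact: JC].
apply: potentD => //; last by apply: potentM => //; exact: potent_group_inverse.
apply: (cg_trans (g * (1 - a * g) * (a + b))).
  by rewrite -!mulrA; apply: cgMl => //; exact: cgC.
rewrite -[0](mul0r (a + b)); apply: cgMr => //.
rewrite mulrBr mulr1 -[0](subrr g); apply: cgD; first exact: cgxx.
by apply: cgN; exact: group_inverse_gag.
Qed.

End GroupInverse.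
End PotentModulo.

(** * Norm estimates and limits *)

Section BanachAlgebra.
Context {R : realType} {A : algType R[i]} (N : A -> R) (HN : banach_algebra_norm N).
Implicit Types (x y z u v w : A) (e r s t : R) (n : nat).

(** The norm of [R[i]] takes its values in [R[i]]; this is the same modulus as an element of [R],
    comparable with values of [N]. *)
Definition cnorm (c : R[i]) : R := complex.Re `|c|.

Lemma cnormE c : `|c| = (cnorm c)%:C.
Proof. by rewrite /cnorm normc_def. Qed.

Lemma cnorm_ge0 c : 0 <= cnorm c.
Proof. by rewrite -(ler0c) -cnormE normr_ge0. Qed.

Lemma cnorm_real r : cnorm r%:C = `|r|.
Proof. by apply: complexI; rewrite -cnormE normc_def /= expr0n addr0 sqrtr_sqr. Qed.

Lemma cnormM c d : cnorm (c * d) = cnorm c * cnorm d.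
Proof. by apply: complexI; rewrite rmorphM /= -!cnormE normrM. Qed.

Lemma norm0 : N 0 = 0.
Proof. by case: HN => h _ _ _ _; apply/h. Qed.

Lemma norm_eq0 x : N x = 0 -> x = 0.
Proof. by case: HN => h _ _ _ _; move/h. Qed.

Lemma normZ c x : N (c *: x) = cnorm c * N x.
Proof. by case: HN => _ h _ _ _; apply: complexI; rewrite h cnormE rmorphM. Qed.

Lemma normD x y : N (x + y) <= N x + N y.
Proof. by case: HN => _ _ h _ _; exact: h. Qed.

Lemma normM x y : N (x * y) <= N x * N y.
Proof. by case: HN => _ _ _ h _; exact: h. Qed.

Lemma normN x : N (- x) = N x.
Proof. by rewrite -scaleN1r normZ /cnorm normrN1 /= mul1r. Qed.

Lemma norm_ge0 x : 0 <= N x.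
Proof. by have := normD x (- x); rewrite subrr norm0 normN; lra. Qed.

Lemma normB x y : N (x - y) <= N x + N y.
Proof. by rewrite -(normN y) normD. Qed.

(** Submultiplicativity gives [N 1 <= N 1 ^+ 2], and [1] is nonzero. The norm is not normalized, so
    [N 1] remains as a factor in later estimates. *)
Lemma norm1_ge1 : 1 <= N 1.
Proof.
have h : 0 < N 1.
  rewrite lt_neqAle norm_ge0 andbT eq_sym; apply/eqP => /norm_eq0 /eqP.
  by rewrite oner_eq0.
by have := normM 1 1; rewrite mulr1 -{1}(mulr1 (N 1)) ler_pM2l.
Qed.

Lemma normX x n : N (x ^+ n) <= N 1 * N x ^+ n.
Proof.
elim: n => [|n IH]; first by rewrite !expr0 mulr1.
rewrite !exprSr mulrA; apply: le_trans (normM _ _) _.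
by apply: ler_wpM2r => //; exact: norm_ge0.
Qed.

Lemma norm_lt_eq0 x : (forall e, 0 < e -> N x < e) -> x = 0.
Proof.
move=> h; apply: norm_eq0; apply/eqP; rewrite eq_le norm_ge0 andbT leNgt.
by apply/negP => /h; rewrite ltxx.
Qed.

Lemma geom_small (K e : R) : 0 < e ->
  exists M : nat, forall n, (M <= n)%N -> K / 2 ^+ n < e.
Proof.
move=> e0; have [M hM] : exists M : nat, `|K| / e < M%:R.
  exists (Num.bound (`|K| / e)); apply: archi_boundP.
  by rewrite divr_ge0 // ltW.
have hp n : (n%:R : R) <= 2 ^+ n.
  by rewrite -natrX ler_nat ltnW // ltn_expl.
exists M => n Mn; rewrite ltr_pdivrMr ?exprn_gt0 //.
rewrite ltr_pdivrMr // in hM.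
apply: le_lt_trans (ler_norm K) _; apply: lt_le_trans hM _.
rewrite mulrC ler_pM2l //; apply: le_trans (hp n); by rewrite ler_nat.
Qed.

Lemma norm_geom_eq0 x (K : R) : (forall n, N x <= K / 2 ^+ n) -> x = 0.
Proof.
move=> h; apply: norm_lt_eq0 => e /(geom_small K) [M hM].
exact: le_lt_trans (h M) (hM M (leqnn M)).
Qed.

Definition tends (f : nat -> A) (l : A) : Prop :=
  forall e, 0 < e -> exists M : nat, forall n, (M <= n)%N -> N (f n - l) < e.

Lemma tends_cst l : tends (fun=> l) l.
Proof. by move=> e e0; exists 0%N => n _; rewrite subrr norm0. Qed.

Lemma tends_uniq {f l l'} : tends f l -> tends f l' -> l = l'.
Proof.
move=> h h'; apply/eqP; rewrite -subr_eq0; apply/eqP; apply: norm_lt_eq0 => e e0.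
have e2 : 0 < e / 2 by lra.
have [M hM] := h _ e2; have [M' hM'] := h' _ e2.
have := hM _ (leq_maxl M M'); have := hM' _ (leq_maxr M M').
set m := maxn M M' => h1 h2.
have -> : l - l' = (f m - l') - (f m - l) by rewrite opprB [RHS]addrC addrA subrK.
by have := normB (f m - l') (f m - l); lra.
Qed.

Lemma tendsD {f g l l'} : tends f l -> tends g l' -> tends (fun n => f n + g n) (l + l').
Proof.
move=> h h' e e0; have e2 : 0 < e / 2 by lra.
have [M hM] := h _ e2; have [M' hM'] := h' _ e2.
exists (maxn M M') => n; rewrite geq_max => /andP[n1 n2].
rewrite opprD addrACA; have := normD (f n - l) (g n - l').
by have := hM _ n1; have := hM' _ n2; lra.
Qed.

Lemma tendsM {f g l l'} : tends f l -> tends g l' -> tends (fun n => f n * g n) (l * l').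
Proof.
move=> h h' e e0; set c := e / (2 * (N l + N l' + 1)).
have p1 := norm_ge0 l; have p2 := norm_ge0 l'.
have D0 : 0 < 2 * (N l + N l' + 1) by lra.
have c0 : 0 < c by rewrite divr_gt0.
have cE : c * (2 * (N l + N l' + 1)) = e by rewrite /c divfK // gt_eqF.
have [M hM] := h _ c0; have c1 : 0 < Num.min c 1.
  by rewrite lt_min c0 ltr01.
have [M' hM'] := h' _ c1.
exists (maxn M M') => n; rewrite geq_max => /andP[n1 n2].
have := hM _ n1; have := hM' _ n2; rewrite lt_min => /andP[h1 h2] h3.
have -> : f n * g n - l * l' =
   (f n - l) * (g n - l') + (l * (g n - l') + (f n - l) * l').
  by rewrite addrA -mulrDl subrK mulrBr mulrBl addrA subrK.
apply: le_lt_trans (normD _ _) _.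
have := normD (l * (g n - l')) ((f n - l) * l').
have := normM l (g n - l'); have := normM (f n - l) l'; have := normM (f n - l) (g n - l').
move: h1 h2 h3 (norm_ge0 (f n - l)) (norm_ge0 (g n - l')).
by nra.
Qed.

Lemma tends_le {f l} {K : R} : tends f l -> (forall n, N (f n) <= K) -> N l <= K.
Proof.
move=> h hK; rewrite leNgt; apply/negP => lt.
have [M hM] := h (N l - K) ltac:(lra).
have := hM _ (leqnn M); have := hK M; have := normB (f M) (f M - l).
by rewrite opprB addrC subrK; lra.
Qed.

Lemma tends_geom (f : nat -> A) (K : R) :
  (forall n, N (f n.+1 - f n) <= K / 2 ^+ n) -> exists l, tends f l.
Proof.
move=> h; have Kge : 0 <= K.
  by have := h 0%N; rewrite expr0 divr1; apply: le_trans; exact: norm_ge0.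
(* The bound telescopes: [K / 2 ^+ i] is [2 * K / 2 ^+ i - 2 * K / 2 ^+ i.+1]. *)
have step m n : N (f (m + n)%N - f m) <= 2 * K / 2 ^+ m - 2 * K / 2 ^+ (m + n).
  elim: n => [|n IH]; first by rewrite addn0 !subrr norm0.
  rewrite addnS; have -> : f (m + n).+1 - f m = (f (m + n).+1 - f (m + n)%N) + (f (m + n)%N - f m).
    by rewrite addrA subrK.
  apply: le_trans (normD _ _) _; have := h (m + n)%N.
  have -> : 2 * K / 2 ^+ (m + n).+1 = K / 2 ^+ (m + n).
    by rewrite exprS; field; rewrite expf_neq0 // pnatr_eq0.
  by rewrite -!mulrA; lra.
have step' m n : (m <= n)%N -> N (f n - f m) <= 2 * K / 2 ^+ m.
  move=> /subnKC <-; apply: le_trans (step _ _) _.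
  by rewrite gerBl divr_ge0 ?mulr_ge0 // exprn_ge0.
case: HN => _ _ _ _ /(_ f) [|l hl]; last by exists l.
move=> e e0; have e2 : 0 < e / 2 by lra.
have [M hM] := geom_small (2 * K) _ e2.
exists M => m n Mm Mn.
have -> : f m - f n = (f m - f M) - (f n - f M) by rewrite opprB addrA subrK.
have := normB (f m - f M) (f n - f M).
have := step' _ _ Mm; have := step' _ _ Mn; have := hM M (leqnn M); lra.
Qed.

(** * Topologically nilpotent elements *)

Definition stable (X : A -> Prop) x := forall v, X v -> X (x * v).
Definition comm_on (X : A -> Prop) x y := forall v, X v -> x * (y * v) = y * (x * v).
(** The constant [C] is uniform in [v], so this speaks of [z] as an operator on [X]. Restricting to
    [X] allows sums and products of elements that commute only there. *)
Definition tnil_on (X : A -> Prop) z := forall e, 0 < e ->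
  exists2 C : R, 0 <= C & forall n v, X v -> N (z ^+ n * v) <= C * e ^+ n * N v.
Definition tnil := tnil_on (fun=> True).

Lemma stableX X x n : stable X x -> stable X (x ^+ n).
Proof.
move=> h; elim: n => [|n IH] v Xv; first by rewrite expr0 mul1r.
by rewrite exprS -mulrA; apply/h/IH.
Qed.

Lemma comm_onX X x y i j : stable X x -> stable X y ->
  comm_on X x y -> comm_on X (x ^+ i) (y ^+ j).
Proof.
move=> sx sy c; elim: i => [|i IH] v Xv; first by rewrite expr0 !mul1r.
rewrite !exprS -!mulrA IH //; have {IH}: X (x ^+ i * v) by exact: stableX.
move: (_ * v) => {Xv}v; elim: j v => [|j IH] v Xv; first by rewrite expr0 !mul1r.
by rewrite !exprS -!mulrA c ?IH //; exact: stableX.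
Qed.

Lemma exprM_on X x y n v : stable X x -> stable X y -> comm_on X x y -> X v ->
  (x * y) ^+ n * v = x ^+ n * (y ^+ n * v).
Proof.
move=> sx sy c Xv; elim: n => [|n IH]; first by rewrite !expr0 !mul1r.
rewrite !exprS -!mulrA IH; congr (x * _).
have := @comm_onX X x y n 1 sx sy c; rewrite expr1 => <- //.
exact: stableX.
Qed.

Definition add_closed (X : A -> Prop) := forall u v, X u -> X v -> X (u + v).

Lemma stableD X x y : add_closed X -> stable X x -> stable X y -> stable X (x + y).
Proof. by move=> aX sx sy v Xv; rewrite mulrDl; apply: aX; [exact: sx|exact: sy]. Qed.

Lemma tnil_onD X x y : add_closed X -> stable X x -> stable X y ->
  comm_on X x y -> tnil_on X x -> tnil_on X y -> tnil_on X (x + y).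
Proof.
move=> aX sx sy c tx ty e e0; have e2 : 0 < e / 2 by lra.
have [C1 C10 h1] := tx _ e2; have [C2 C20 h2] := ty _ e2.
exists (C1 * C2) => [|n v Xv]; first exact: mulr_ge0.
(* A binomial expansion in disguise: with some powers of [x] and [y] already moved to the left,
   peeling off one factor [x + y] leaves two terms, each bounded by half of the target. *)
suff h i j : N (x ^+ i * (y ^+ j * ((x + y) ^+ n * v))) <=
    C1 * C2 * (e / 2) ^+ i * (e / 2) ^+ j * e ^+ n * N v.
  by have := h 0%N 0%N; rewrite !expr0 !mul1r !mulr1.
elim: n i j => [|n IH] i j.
  rewrite !expr0 mul1r mulr1; apply: le_trans (h1 i _ (stableX _ _ j sy _ Xv)) _.
  have -> : C1 * C2 * (e / 2) ^+ i * (e / 2) ^+ j * N v =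
    C1 * (e / 2) ^+ i * (C2 * (e / 2) ^+ j * N v) by ring.
  by apply: ler_wpM2l; [rewrite mulr_ge0 // exprn_ge0 // ltW | exact: h2].
have Xw : X ((x + y) ^+ n * v) by apply: stableX => //; exact: stableD.
rewrite exprS -mulrA mulrDl !mulrDr.
have -> : y ^+ j * (x * ((x + y) ^+ n * v)) = x * (y ^+ j * ((x + y) ^+ n * v)).
  by have := comm_onX X x y 1 j sx sy c _ Xw; rewrite expr1.
rewrite [x ^+ i * (x * _)]mulrA [y ^+ j * (y * _)]mulrA -!exprSr.
apply: le_trans (normD _ _) _.
have := IH i.+1 j; have := IH i j.+1.
have -> : C1 * C2 * (e / 2) ^+ i * (e / 2) ^+ j * e ^+ n.+1 * N v =
  C1 * C2 * (e / 2) ^+ i.+1 * (e / 2) ^+ j * e ^+ n * N v +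
  C1 * C2 * (e / 2) ^+ i * (e / 2) ^+ j.+1 * e ^+ n * N v.
  by rewrite !exprS; field.
by lra.
Qed.

Lemma normX_mul x v n : N (x ^+ n * v) <= N x ^+ n * N v.
Proof.
elim: n => [|n IH]; first by rewrite !expr0 !mul1r.
rewrite !exprS -!mulrA; apply: le_trans (normM _ _) _.
by apply: ler_wpM2l => //; exact: norm_ge0.
Qed.

(** On [X], [(w x) ^+ n] acts as [w ^+ n x ^+ n], and testing [x] at [e / (N w + 1)] pays for
    [N w ^+ n]; the [+ 1] keeps the divisor positive. *)
Lemma tnil_onM X x w : stable X x -> stable X w -> comm_on X w x ->
  tnil_on X x -> tnil_on X (w * x).
Proof.
move=> sx sw c tx e e0; have w0 : 0 < N w + 1 by have := norm_ge0 w; lra.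
have [C C0 h] := tx (e / (N w + 1)) (divr_gt0 e0 w0).
exists C => // n v Xv; rewrite (exprM_on X) //.
apply: le_trans (normX_mul _ _ _) _.
have -> : C * e ^+ n * N v = (N w + 1) ^+ n * (C * (e / (N w + 1)) ^+ n * N v).
  rewrite expr_div_n; field; by rewrite expf_neq0 // gt_eqF.
apply: ler_pM; rewrite ?exprn_ge0 ?norm_ge0 ?h //.
by rewrite lerXn2r ?nnegrE ?norm_ge0 ?ltW //; lra.
Qed.

Lemma tnil_on_eq X x y : stable X x -> (forall v, X v -> x * v = y * v) ->
  tnil_on X x -> tnil_on X y.
Proof.
move=> sx exy tx e /tx [C C0 h]; exists C => // n v Xv.
suff -> : y ^+ n * v = x ^+ n * v by exact: h.
elim: n => [|n IH]; first by rewrite !expr0.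
by rewrite !exprS -!mulrA IH exy //; exact: stableX.
Qed.

Lemma tnil_on0 X : tnil_on X 0.
Proof.
move=> e e0; exists 1 => // -[|n] v _; first by rewrite !expr0 !mul1r.
by rewrite expr0n mul0r norm0 mul1r mulr_ge0 ?norm_ge0 // exprn_ge0 // ltW.
Qed.

Lemma tnil_tnil_on X x : tnil x -> tnil_on X x.
Proof. by move=> h e /h [C C0 {}h]; exists C => // n v _; exact: h. Qed.

Lemma tnil_norm x e : tnil x -> 0 < e ->
  exists2 C : R, 0 <= C & forall n, N (x ^+ n) <= C * e ^+ n.
Proof.
move=> h /h [C C0 {}h]; exists (C * N 1) => [|n]; first by rewrite mulr_ge0 ?norm_ge0.
by rewrite mulrAC -(mulr1 (x ^+ n)) h.
Qed.

Lemma norm_tnil x : (forall e, 0 < e -> exists C : R, forall n, N (x ^+ n) <= C * e ^+ n) ->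
  tnil x.
Proof.
move=> h e /h [C {}h]; exists C => [|n v _].
  by have := h 0%N; rewrite !expr0 mulr1; apply: le_trans; exact: norm_ge0.
by apply: le_trans (normM _ _) _; rewrite ler_wpM2r ?norm_ge0.
Qed.

Lemma tnilD x y : x * y = y * x -> tnil x -> tnil y -> tnil (x + y).
Proof. by move=> c; apply: tnil_onD => // v _; rewrite !mulrA c. Qed.

Lemma tnilM x w : w * x = x * w -> tnil x -> tnil (w * x).
Proof. by move=> c; apply: tnil_onM => // v _; rewrite !mulrA c. Qed.

Lemma tnilN x : tnil x -> tnil (- x).
Proof. by rewrite -mulN1r; apply: tnilM; rewrite mulN1r mulrN1. Qed.

Lemma tends_eq {f g : nat -> A} {l} : f =1 g -> tends f l -> tends g l.
Proof. by move=> fg h e /h [M hM]; exists M => n; rewrite -fg; exact: hM. Qed.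

Lemma tends_exp_tnil x : tnil x -> tends (fun n => x ^+ n) 0.
Proof.
move=> tx e e0; have [|C C0 h] := tnil_norm _ (1 / 2) tx; first by lra.
have [M hM] := geom_small C _ e0; exists M => n Mn; rewrite subr0.
by apply: le_lt_trans (h n) _; rewrite mul1r exprVn; exact: hM.
Qed.

(** Neumann series: the partial sums [f n] converge since [N (x ^+ n)] is at most [C / 2 ^+ n].
    Commutation with [u] then follows from [u] being a two-sided inverse of [1 - x]. *)
Lemma tnil_geom x : tnil x -> exists u, [/\ (1 - x) * u = 1, u * (1 - x) = 1 &
  forall c, c * x = x * c -> c * u = u * c].
Proof.
move=> tx; pose f n := \sum_(i < n) x ^+ i.
have [|C C0 h] := tnil_norm _ (1 / 2) tx; first by lra.
have [u hu] : exists u, tends f u.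
  apply: (tends_geom _ C) => n; rewrite /f big_ord_recr /= addrAC subrr add0r.
  by rewrite -exprVn -(mul1r 2^-1).
have fl n : (1 - x) * f n = 1 - x ^+ n by rewrite -opprB mulNr -subrX1 opprB.
have fr n : f n * (1 - x) = 1 - x ^+ n.
  rewrite -fl mulrBl mulrBr mulr1 mul1r; congr (_ - _).
  by rewrite /f mulr_sumr mulr_suml; apply: eq_bigr => i _; rewrite -exprS -exprSr.
have h1 : tends (fun n => 1 - x ^+ n) 1.
  have := tendsD (tends_cst 1) (tendsM (tends_cst (-1)) (tends_exp_tnil _ tx)).
  by rewrite mulr0 addr0; apply: tends_eq => n; rewrite mulN1r.
have ul : (1 - x) * u = 1.
  by apply: (tends_uniq (tendsM (tends_cst _) hu)); apply: tends_eq h1 => n; rewrite fl.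
have ur : u * (1 - x) = 1.
  by apply: (tends_uniq (tendsM hu (tends_cst _))); apply: tends_eq h1 => n; rewrite fr.
exists u; split=> // c cx.
have cx' : c * (1 - x) = (1 - x) * c by rewrite mulrBl mulrBr mulr1 mul1r cx.
by rewrite -[LHS]mul1r -{1}ur -!mulrA (mulrA _ c) -cx' -mulrA ul mulr1.
Qed.

(** Here [1 = x ^+ n y ^+ n], and [x ^+ n] decays faster than [y ^+ n] can grow, so [1] would be
    [0]. *)
Lemma tnil_not_unit x y : tnil x -> x * y = y * x -> x * y = 1 -> False.
Proof.
move=> tx c xy; have y0 : 0 < 2 * (N y + 1) by have := norm_ge0 y; lra.
have [C C0 h] := tnil_norm _ (2 * (N y + 1))^-1 tx ltac:(by rewrite invr_gt0).
suff /eqP : 1 = 0 :> A by rewrite oner_eq0.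
apply: (norm_geom_eq0 _ (C * N 1)) => n.
have -> : N 1 = N (x ^+ n * y ^+ n) by rewrite -exprMn_comm // xy expr1n.
apply: le_trans (normM _ _) _.
have -> : C * N (x ^+ n * y ^+ n) / 2 ^+ n = C * (2 * (N y + 1))^-1 ^+ n * (N 1 * (N y + 1) ^+ n).
  rewrite -exprMn_comm // xy expr1n exprVn exprMn; field.
  by rewrite !expf_neq0 // gt_eqF //; have := norm_ge0 y; lra.
apply: ler_pM; rewrite ?norm_ge0 ?h //.
apply: le_trans (normX _ _) _; rewrite ler_wpM2l ?norm_ge0 // lerXn2r ?nnegrE ?norm_ge0 //.
  by have := norm_ge0 y; lra.
by lra.
Qed.

Lemma tnil_quasinilpotent x : tnil x -> quasinilpotent x.
Proof.
move=> tx; apply/seteqP; split=> l /=; last first.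
  move=> -> [y [h1 h2]]; rewrite scale0r sub0r in h1 h2.
  by apply: (tnil_not_unit (- x) y (tnilN _ tx)); rewrite ?h1 ?h2.
move=> h; apply/eqP; apply/negP => /negP l0; apply: h.
have : tnil (l^-1%:A * x).
  by apply: tnilM => //; rewrite -scalerAl mul1r -scalerAr mulr1.
move=> /tnil_geom [u [h1 h2 _]].
have E : l%:A - x = l *: (1 - l^-1%:A * x).
  by rewrite scalerBr -scalerAl mul1r scalerA divff // scale1r.
exists (l^-1 *: u); rewrite E; move: (1 - _) h1 h2 => w h1 h2.
rewrite -!scalerAl -!scalerAr h1 h2 !scalerA.
by rewrite divff // mulVf // scale1r.
Qed.
(** * Lifting idempotents *)

(* [u] has operator norm at most [r] for the norm [sup_n N (x ^+ n * v) / e ^+ n] on [v],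
   for which [x] itself has norm at most [e]. *)
Definition tbounded (x : A) (e : R) (u : A) (r : R) := forall v (K : R),
  (forall n, N (x ^+ n * v) <= K * e ^+ n) ->
  forall n, N (x ^+ n * (u * v)) <= r * K * e ^+ n.

Section Tbounded.
Variables (x : A) (e : R).
Local Notation tb := (tbounded x e).

Lemma tbounded0 : tb 0 0.
Proof. by move=> v K _ n; rewrite mul0r mulr0 !mul0r norm0. Qed.

Lemma tbounded1 : tb 1 1.
Proof. by move=> v K h n; rewrite !mul1r. Qed.

Lemma tbounded_id : tb x e.
Proof.
move=> v K h n; rewrite mulrA -exprSr; have := h n.+1.
by rewrite (exprS e) mulrA (mulrC K).
Qed.

Lemma tboundedD u v r s : tb u r -> tb v s -> tb (u + v) (r + s).
Proof.
move=> hu hv w K hw n; rewrite mulrDl mulrDr !mulrDl.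
by apply: le_trans (normD _ _) _; apply: lerD; [exact: hu | exact: hv].
Qed.

Lemma tboundedM u v r s : tb u r -> tb v s -> tb (u * v) (r * s).
Proof. by move=> hu hv w K hw n; rewrite -mulrA -(mulrA r); apply/hu/hv. Qed.

Lemma tboundedMn u r k : tb u r -> tb (u *+ k) (r *+ k).
Proof.
by move=> h; elim: k => [|k IH]; [exact: tbounded0 | rewrite !mulrS; exact: tboundedD].
Qed.

Lemma tboundedX u r k : tb u r -> tb (u ^+ k) (r ^+ k).
Proof.
by move=> h; elim: k => [|k IH]; [exact: tbounded1 | rewrite !exprS; exact: tboundedM].
Qed.

Lemma tbounded_le u r s : 0 <= e -> r <= s -> tb u r -> tb u s.
Proof.
move=> e0 rs h v K hv n; apply: le_trans (h v K hv n) _.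
have K0 : 0 <= K.
  by have := hv 0%N; rewrite !expr0 mul1r mulr1; apply: le_trans; exact: norm_ge0.
by rewrite !ler_wpM2r ?exprn_ge0.
Qed.

Lemma tbounded_tends (f : nat -> A) u r : tends f u -> (forall n, tb (f n) r) -> tb u r.
Proof.
move=> fu h v K hv n; have hl := tendsM (tends_cst (x ^+ n)) (tendsM fu (tends_cst v)).
by apply: (tends_le hl) => m; exact: h.
Qed.

Lemma tbounded_norm u r (K : R) : (forall n, N (x ^+ n) <= K * e ^+ n) ->
  tb u r -> N u <= r * K.
Proof.
move=> hK h; have := h 1 K (fun n => _) 0%N; rewrite !expr0 mul1r !mulr1; apply=> n.
by rewrite mulr1.
Qed.

End Tbounded.

(* At [n = 0], [d = x - x^2]. The invariant [q^2 (1 - 2x)^2 = 1 - 4d], with [d -> 0], makes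
   [(1 - 2x) lim q] a square root of [1]. *)
Fixpoint newton (n : nat) : {poly R[i]} * {poly R[i]} :=
  if n is k.+1 then let: (d, q) := newton k in
    (d * d * (1 *+ 3 + d *+ 4), q * (1 + d *+ 2))
  else ('X - 'X * 'X, 1).

Lemma newton_sqr n : (newton n).2 ^+ 2 * (1 - 'X *+ 2) ^+ 2 = 1 - (newton n).1 *+ 4.
Proof.
elim: n => [|n] /=; first by ring.
case: (newton n) => d q /= IH; rewrite exprMn mulrAC IH; ring.
Qed.

Lemma horner_alg_comm c x (P : {poly R[i]}) : c * x = x * c ->
  c * horner_alg x P = horner_alg x P * c.
Proof.
move=> cx; elim/poly_ind: P => [|P a IH]; first by rewrite rmorph0 mulr0 mul0r.
rewrite rmorphD rmorphM /= horner_algX horner_algC mulrDr mulrDl.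
congr (_ + _); last by rewrite -scalerAr mulr1 -scalerAl mul1r.
by rewrite mulrA IH -!mulrA cx.
Qed.

Lemma tends_comm c (f : nat -> A) u : tends f u -> (forall n, c * f n = f n * c) ->
  c * u = u * c.
Proof.
move=> fu h; apply: (tends_uniq (tendsM (tends_cst c) fu)).
by apply: tends_eq (tendsM fu (tends_cst c)) => n; rewrite h.
Qed.

Lemma horner_newtonS x n :
  let D := horner_alg x (newton n).1 in let Q := horner_alg x (newton n).2 in
  horner_alg x (newton n.+1).1 = D * D * (1 *+ 3 + D *+ 4) /\
  horner_alg x (newton n.+1).2 = Q * (1 + D *+ 2).
Proof.
rewrite /=; case: (newton n) => d q /=; rewrite !rmorphM.
rewrite (rmorphD _ (1 *+ 3) (d *+ 4)) (rmorphD _ 1 (d *+ 2)).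
have e1 : horner_alg x 1 = 1 by exact: rmorph1.
by rewrite !raddfMn /= !e1.
Qed.

(** Since [d] is replaced by [d ^+ 2 (3 + 4 d)], a bound at most [1 / 8] at least halves. The
    increment of [q] is then at most [4 e / 2 ^+ n], and the first [n] of these sum to
    [8 e (1 - 1 / 2 ^+ n)]. *)
Lemma newton_tbounded x e n : 0 <= e -> e <= 1 / 8 ->
  let y := x - x * x in
  tbounded y e (horner_alg x (newton n).1) (e / 2 ^+ n) /\
  tbounded y e (horner_alg x (newton n).2 - 1) (8 * e * (1 - (2 ^+ n)^-1)).
Proof.
move=> e0 e8 y; elim: n => [|n].
  rewrite /= expr0 divr1 invr1 subrr mulr0 rmorphB rmorphM rmorph1 /= horner_algX subrr.
  by split; [exact: tbounded_id | exact: tbounded0].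
have [-> ->] := horner_newtonS x n.
move: (horner_alg x (newton n).1) (horner_alg x (newton n).2) => D Q [hd hq].
set h := (2 ^+ n)^-1 in hd hq.
have h0 : 0 <= h by rewrite invr_ge0 exprn_ge0.
have h1 : h <= 1 by rewrite invf_le1 ?exprn_gt0 // exprn_ege1 // ler1n.
have hh : (2 ^+ n.+1)^-1 = h / 2 by rewrite exprS invfM mulrC.
rewrite hh; split.
  have := tboundedM _ _ _ _ _ _ (tboundedM _ _ _ _ _ _ hd hd)
    (tboundedD _ _ _ _ _ _ (tboundedMn _ _ _ _ 3 (tbounded1 _ _)) (tboundedMn _ _ _ _ 4 hd)).
  apply: tbounded_le => //; have : 0 <= e * h <= 1 / 8 by apply/andP; split; nra.
  set g := e * h; have -> : e * (h / 2) = g / 2 by rewrite /g mulrA.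
  by nra.
have -> : Q * (1 + D *+ 2) - 1 = (Q - 1) + ((Q - 1) * (D *+ 2) + D *+ 2).
  by rewrite mulrBl mul1r subrK mulrDr mulr1 addrAC.
have h2 := tboundedMn _ _ _ _ 2 hd.
have := tboundedD _ _ _ _ _ _ hq (tboundedD _ _ _ _ _ _ (tboundedM _ _ _ _ _ _ hq h2) h2).
apply: tbounded_le => //; rewrite mulr2n.
have g0 : 0 <= e * h by exact: mulr_ge0.
have g1 : 8 * e * (1 - h) <= 1 by nra.
have -> : 8 * e * (1 - h / 2) = 8 * e * (1 - h) + 4 * (e * h) by field.
move: (8 * e * (1 - h)) g1 => g g1; nra.
Qed.

(** With [Q] the limit of the Newton factors, [F = (1 - 2 x) Q] squares to [1], so [p = (1 - F) / 2]
    is idempotent, and [p - x = - (1 - 2 x) (Q - 1) / 2] inherits topological nilpotency from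
    [Q - 1]. As [Q] is a limit of polynomials in [x], it commutes with whatever commutes with
    [x]. *)
Lemma idempotent_lift x : tnil (x - x * x) ->
  exists p, [/\ p * p = p, tnil (p - x) & forall c, c * x = x * c -> c * p = p * c].
Proof.
move=> ty; pose y := x - x * x.
pose d n := horner_alg x (newton n).1; pose q n := horner_alg x (newton n).2.
have e8 : 0 < (1 / 8 : R) by lra.
have [K K0 hK] := tnil_norm _ _ ty e8.
have nb n := newton_tbounded x _ n (ltW e8) (lexx _).
have [Q hQ] : exists Q, tends q Q.
  apply: (tends_geom _ K) => n; rewrite /q; have [_ ->] := horner_newtonS x n; have [] := nb n.
  move: (horner_alg x (newton n).1) (horner_alg x (newton n).2) => D P hd hq.
  set h := (2 ^+ n)^-1 in hd hq *.
  have h0 : 0 <= h by rewrite invr_ge0 exprn_ge0.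
  have h1 : h <= 1 by rewrite invf_le1 ?exprn_gt0 // exprn_ege1 // ler1n.
  have -> : P * (1 + D *+ 2) - P = (P - 1) * (D *+ 2) + D *+ 2.
    by rewrite mulrBl mul1r subrK mulrDr mulr1 addrAC subrr add0r.
  have h2 := tboundedMn _ _ _ _ 2 hd.
  have := tboundedD _ _ _ _ _ _ (tboundedM _ _ _ _ _ _ hq h2) h2.
  move/(tbounded_norm _ _ _ _ _ hK) => hN; apply: le_trans hN _.
  rewrite mulrC ler_wpM2l // mulr2n.
  have : 0 <= 8 * (1 / 8) * (1 - h) <= 1 by apply/andP; split; lra.
  by move: (8 * _ * _) => g; nra.
have hd : tends d 0.
  move=> e /(geom_small K) [M hM]; exists M => n Mn; rewrite subr0.
  apply: le_lt_trans (hM n Mn); have [/(tbounded_norm _ _ _ _ _ hK) h _] := nb n.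
  apply: le_trans h _; rewrite mulrC ler_wpM2l //.
  by rewrite ler_piMl ?invr_ge0 ?exprn_ge0 //; lra.
have Qc c : c * x = x * c -> c * Q = Q * c.
  by move=> cx; apply: tends_comm hQ _ => n; exact: horner_alg_comm.
pose f := 1 - x *+ 2; pose F := f * Q.
have fc c : c * x = x * c -> c * f = f * c.
  by move=> cx; rewrite /f mulrBl mulrBr mul1r mulr1 mulrnAr mulrnAl cx.
have fQ : f * Q = Q * f by apply: Qc; rewrite -fc.
have FF : F * F = 1.
  apply: (tends_uniq (tendsM (tendsM (tends_cst f) hQ) (tendsM (tends_cst f) hQ))).
  have h := tendsD (tends_cst 1) (tendsM (tends_cst (- 4%:R)) hd).
  rewrite mulr0 addr0 in h; apply: tends_eq h => n.
  have e1 : horner_alg x 1 = 1 by exact: rmorph1.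
  have Ef : horner_alg x (1 - 'X *+ 2) = f.
    by rewrite rmorphB raddfMn /= horner_algX e1.
  have E : q n ^+ 2 * f ^+ 2 = 1 - d n *+ 4.
    have <- : horner_alg x (1 - (newton n).1 *+ 4) = 1 - d n *+ 4.
      by rewrite rmorphB raddfMn /= e1.
    by rewrite -newton_sqr -Ef rmorphM /= !rmorphXn.
  have fq : f * q n = q n * f by apply: horner_alg_comm; rewrite -fc.
  have -> : f * q n * (f * q n) = q n ^+ 2 * f ^+ 2.
    by rewrite !expr2 [in LHS]fq -!mulrA [f * (q n * f)]mulrA fq !mulrA.
  by rewrite E mulNr mulr_natl.
(* Convergence used the single scale [1 / 8]. The same estimates at an arbitrarily small scale [e']
   bound [Q - 1] by [8 e' <= e] in the adapted norm, hence [(Q - 1) ^+ n] by [e ^+ n]. *)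
have tQ : tnil (Q - 1).
  apply: norm_tnil => e e0; pose e' := Num.min (e / 8) (1 / 8).
  have e'0 : 0 < e' by rewrite lt_min; apply/andP; split; lra.
  have [e'1 e'2] : e' <= e / 8 /\ e' <= 1 / 8.
    by split; rewrite ge_min lexx ?orbT.
  have [C C0 hC] := tnil_norm _ _ ty e'0; exists C => n.
  have tb : tbounded y e' (Q - 1) e.
    have hQ1 := tendsD hQ (tends_cst (- 1)).
    apply: (tbounded_tends _ _ _ _ _ hQ1) => k.
    have [_] := newton_tbounded x e' k (ltW e'0) e'2; apply: tbounded_le; first exact: ltW.
    have : (0 : R) <= (2 ^+ k)^-1 by rewrite invr_ge0 exprn_ge0.
    by nra.
  by rewrite mulrC; apply: (tbounded_norm y e' _ _ _ hC); exact: tboundedX.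
have Fc c : c * x = x * c -> c * F = F * c.
  by move=> cx; rewrite /F mulrA (fc c) // -!mulrA (Qc c).
pose p : A := (2 : R[i])^-1 *: (1 - F); exists p; split.
- rewrite /p -scalerAl -scalerAr scalerA.
  have -> : (1 - F) * (1 - F) = (2 : R[i]) *: (1 - F).
    by rewrite mulrBl mul1r mulrBr mulr1 FF opprB scaler_nat mulr2n.
  by rewrite scalerA -mulrA mulVf ?mulr1 // pnatr_eq0.
- have -> : p - x = (- (2 : R[i])^-1 *: f) * (Q - 1).
    rewrite -scalerAl mulrBr mulr1 -/F scaleNr -scalerN opprB /p.
    have {1}-> : x = (2 : R[i])^-1 *: (x *+ 2).
      by rewrite -[x *+ 2]scaler_nat scalerA mulVf ?scale1r // pnatr_eq0.
    by rewrite -scalerBr /f addrAC.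
  apply: tnilM => //; rewrite -scalerAl -scalerAr; congr (_ *: _).
  by rewrite [f * _]mulrBr [_ * f]mulrBl mulr1 mul1r fQ.
- by move=> c cx; rewrite /p -scalerAl -scalerAr mulrBr mulrBl mulr1 mul1r Fc.
Qed.

(** The lifted [p] satisfies [p e = p (1 - (p - e))], so [e = z ^+ m.+1] is invertible on the range
    of [p], with inverse [u] there, and [x = p z ^+ m u] inverts [z] on that range. *)
Lemma tnil_gpiH z m : tnil (z - z ^+ m.+2) -> gpiH_invertible z.
Proof.
move=> tz; pose e := z ^+ m.+1.
have [|p [pp tp pc]] := idempotent_lift e.
  have -> : e - e * e = z ^+ m * (z - z ^+ m.+2).
    by rewrite mulrBr -exprSr /e -!exprD addSnnS.
  apply: tnilM => //; rewrite mulrBr mulrBl -exprSr -exprS -!exprD.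
  by rewrite addnC.
have ze : z * e = e * z by rewrite -exprS -exprSr.
have zp : z * p = p * z by exact: pc.
have ep : e * p = p * e by exact: pc.
have zt : z * (p - e) = (p - e) * z by rewrite mulrBr mulrBl zp ze.
have [u [u1 u2 uc]] := tnil_geom _ tp.
have zu := uc _ zt.
have pu : p * u = u * p by apply: uc; rewrite mulrBr mulrBl ep.
have peu : p * (e * u) = p.
  rewrite -[RHS]mulr1 -u1 mulrA [p * (_ * u)]mulrA; congr (_ * u).
  by rewrite mulrBr mulr1 mulrBr pp opprB addrC subrK.
have zm : z ^+ m * p = p * z ^+ m by apply/esym/commrX.
have um : u * z ^+ m = z ^+ m * u by apply: commrX.
pose x := p * z ^+ m * u.
have xz : x * z = p.
  by rewrite /x -!mulrA -zu [z ^+ m * _]mulrA -exprSr peu.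
have zx : z * x = p.
  by rewrite /x !mulrA zp -(mulrA p) -exprS -mulrA peu.
exists x; split; rewrite ?xz ?zx //.
  by rewrite /x -!(mulrA p) (mulrA p p) pp.
exists m.+1; split => //.
(* Here [z ^+ m.+3 x] is [z ^+ m.+2 p]. As [(1 - p) (p - e) = - (1 - p) e], the defect becomes a sum
   of two commuting topologically nilpotent terms. *)
have -> : z - z ^+ m.+3 * x = (z - z ^+ m.+2) + - (z * (1 - p)) * (p - e).
  have p0 : (1 - p) * p = 0 by rewrite mulrBl mul1r pp subrr.
  have zpe : z * (p * e) = z ^+ m.+2 * p by rewrite -ep mulrA -exprS.
  rewrite exprSr -mulrA zx mulNr -[z * (1 - p) * _]mulrA [(1 - p) * _]mulrBr p0 sub0r mulrN opprK.
  by rewrite mulrBl mul1r mulrBr zpe -exprS addrA subrK.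
have zq i : z ^+ i * (p - e) = (p - e) * z ^+ i by apply/esym/commrX/esym.
have zzp i : z ^+ i * p = p * z ^+ i by apply/esym/commrX/esym.
have wc : (1 - p) * (p - e) = (p - e) * (1 - p).
  by rewrite [LHS]mulrBl [RHS]mulrBr mul1r mulr1 mulrBr mulrBl ep.
have c1 : z * (1 - p) * (p - e) = (p - e) * (z * (1 - p)).
  by rewrite -mulrA wc mulrA zt mulrA.
apply: tnil_quasinilpotent; apply: tnilD => //; last first.
  by apply: tnilM => //; rewrite mulNr mulrN c1.
have c2 : (z - z ^+ m.+2) * z = z * (z - z ^+ m.+2).
  by rewrite mulrBl mulrBr -exprS -exprSr.
have c3 : (z - z ^+ m.+2) * p = p * (z - z ^+ m.+2).
  by rewrite mulrBl mulrBr zp zzp.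
have c4 : (z - z ^+ m.+2) * (p - e) = (p - e) * (z - z ^+ m.+2).
  by rewrite [LHS]mulrBl [RHS]mulrBr zt zq.
move: (z - _) c2 c3 c4 => w c2 c3 c4.
have c5 : w * (1 - p) = (1 - p) * w by rewrite [LHS]mulrBr [RHS]mulrBl mulr1 mul1r c3.
by rewrite mulNr mulrN mulNr !mulrA c2 -(mulrA z) c5 -!mulrA c4.
Qed.
(** * Quasinilpotent elements are topologically nilpotent *)

Lemma cnorm_def c : cnorm c = Num.sqrt (complex.Re c ^+ 2 + complex.Im c ^+ 2).
Proof. by apply: complexI; rewrite -cnormE normc_def. Qed.

Lemma cnorm_leReIm c : cnorm c <= `|complex.Re c| + `|complex.Im c|.
Proof.
rewrite cnorm_def -[leRHS]ger0_norm ?addr_ge0 // -sqrtr_sqr; apply: ler_wsqrtr.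
rewrite -(real_normK (num_real (complex.Re c))) -(real_normK (num_real (complex.Im c))).
by have := normr_ge0 (complex.Re c); have := normr_ge0 (complex.Im c); nra.
Qed.

Lemma Re_le_cnorm c : `|complex.Re c| <= cnorm c.
Proof.
by rewrite cnorm_def -sqrtr_sqr; apply: ler_wsqrtr; rewrite lerDl sqr_ge0.
Qed.

Lemma Im_le_cnorm c : `|complex.Im c| <= cnorm c.
Proof.
by rewrite cnorm_def -sqrtr_sqr; apply: ler_wsqrtr; rewrite lerDr sqr_ge0.
Qed.

(** * The resolvent [(1 - l z)^-1] and powers of two *)

Definition inverse_of x y := x * y = 1 /\ y * x = 1.

Section Resolvent.
Variables (z : A) (f : R[i] -> A).
Hypothesis fP : forall l, inverse_of (1 - l *: z) (f l).

Lemma resolventB l m : f m - f l = (m - l) *: (f l * z * f m).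
Proof.
have [_ hl] := fP l; have [hm _] := fP m.
have -> : f m - f l = f l * ((1 - l *: z) - (1 - m *: z)) * f m.
  by rewrite mulrBr mulrBl hl mul1r -mulrA hm mulr1.
rewrite opprB addrC addrA subrK -scalerBl -scalerAr -scalerAl.
by [].
Qed.

Lemma resolvent_bounded r : exists M : R, forall l, cnorm l <= r -> N (f l) <= M.
Proof.
have [x y|M hM] := locally_bounded_square _ (fun a b : R => N (f (a +i* b))) r.
  set l := x +i* y; set k := N (f l * z).
  have k0 : 0 <= k by exact: norm_ge0.
  (* With this radius for both coordinates, [cnorm (m - l) * k <= 1 / 2], and the resolvent identity
     gives [N (f m) <= N (f l) + N (f m) / 2]. *)
  exists (1 / (4 * (k + 1))); first by rewrite divr_gt0 //; lra.
  exists (2 * N (f l)) => x' y' hx hy; set m := x' +i* y'.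
  have hml : cnorm (m - l) <= 1 / (2 * (k + 1)).
    apply: le_trans (cnorm_leReIm _) _ => /=.
    have -> : 1 / (2 * (k + 1)) = 1 / (4 * (k + 1)) + 1 / (4 * (k + 1)) :> R.
      by field; lra.
    by apply: lerD; exact: ltW.
  have hk : cnorm (m - l) * k <= 1 / 2.
    apply: le_trans (ler_wpM2r k0 hml) _.
    by rewrite mulrAC mul1r ler_pdivrMr; lra.
  have := normD (f m - f l) (f l); rewrite subrK resolventB normZ.
  have := normM (f l * z) (f m); rewrite -/k.
  move: (cnorm_ge0 (m - l)) (norm_ge0 (f m)) (norm_ge0 (f l)) hk.
  move: (cnorm _) (N _) (N (f m)) (N (f l)) => c a b d c0 b0 d0 hk h1 h2.
  have : c * a <= 1 / 2 * b.
    apply: le_trans (ler_wpM2l c0 h1) _; rewrite mulrA; exact: ler_wpM2r.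
  lra.
exists M => l hl; have := hM (complex.Re l) (complex.Im l).
have -> : complex.Re l +i* complex.Im l = l by case: l {hl}.
by apply; [apply: le_trans (Re_le_cnorm _) hl | apply: le_trans (Im_le_cnorm _) hl].
Qed.

End Resolvent.

Lemma inverse_of_half w g h : inverse_of (1 - w) g -> inverse_of (1 + w) h ->
  inverse_of (1 - w * w) ((2 : R[i])^-1 *: (g + h)).
Proof.
move=> [g1 g2] [h1 h2].
have e1 : 1 - w * w = (1 + w) * (1 - w).
  by rewrite mulrBr mulr1 mulrDl mul1r opprD addrA addrK.
have e2 : 1 - w * w = (1 - w) * (1 + w).
  by rewrite mulrDr mulr1 mulrBl mul1r addrA subrK.
have e3 : (2 : R[i])^-1 *: ((1 + w) + (1 - w)) = 1.
  rewrite addrACA subrr addr0 -mulr2n -(scaler_nat 2 (1 : A)) scalerA mulVf ?scale1r //.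
  by rewrite pnatr_eq0.
split.
  rewrite -scalerAr mulrDr {1}e1 e2 -!mulrA g1 h1 !mulr1; exact: e3.
rewrite -scalerAl mulrDl {1}e2 e1 [g * _]mulrA [h * _]mulrA g2 h2 !mul1r; exact: e3.
Qed.

(* Averaging over the square roots of [u]: [1/(1-w^2) = (1/(1-w) + 1/(1+w)) / 2]. *)
Lemma resolvent_pow2 z (f : R[i] -> A) s t (M e : R) :
  (forall l, inverse_of (1 - l *: z) (f l)) ->
  (forall l, cnorm l <= Num.max s t -> N (f l) <= M) ->
  0 <= s -> 0 <= t -> `|s - t| * (M * N z * M) <= e ->
  forall (j : nat) (u : R[i]), cnorm u = 1 -> exists g h,
    [/\ inverse_of (1 - ((s ^+ (2 ^ j))%:C * u) *: z ^+ (2 ^ j)) g,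
        inverse_of (1 - ((t ^+ (2 ^ j))%:C * u) *: z ^+ (2 ^ j)) h & N (g - h) <= e].
Proof.
move=> fP fM s0 t0 he; elim=> [|j IH] u u1.
  exists (f (s%:C * u)), (f (t%:C * u)); rewrite !expn0 !expr1; split; try exact: fP.
  rewrite (resolventB z f fP) normZ -mulrBl cnormM u1 mulr1 -rmorphB cnorm_real.
  apply: le_trans _ he; apply: ler_wpM2l => //.
  have b1 : N (f (s%:C * u)) <= M.
    by apply: fM; rewrite cnormM u1 mulr1 cnorm_real ger0_norm // le_max lexx.
  have b2 : N (f (t%:C * u)) <= M.
    by apply: fM; rewrite cnormM u1 mulr1 cnorm_real ger0_norm // le_max lexx orbT.
  apply: le_trans (normM _ _) _; apply: ler_pM; rewrite ?norm_ge0 //.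
  apply: le_trans (normM _ _) _; by rewrite ler_wpM2r ?norm_ge0.
pose v := sqrtc u; have vv : v * v = u by rewrite -expr2 sqr_sqrtc.
have v1 : cnorm v = 1.
  apply/eqP; rewrite -(@eqrXn2 _ 2) ?cnorm_ge0 //.
  by rewrite expr1n expr2 -cnormM vv u1.
have vN1 : cnorm (- v) = 1 by rewrite -v1 /cnorm normrN.
have [g [h [gP hP gh]]] := IH _ v1; have [g' [h' [gP' hP' gh']]] := IH _ vN1.
have E r : 1 - ((r ^+ (2 ^ j.+1))%:C * u) *: z ^+ (2 ^ j.+1) =
    1 - (((r ^+ (2 ^ j))%:C * v) *: z ^+ (2 ^ j)) * (((r ^+ (2 ^ j))%:C * v) *: z ^+ (2 ^ j)).
  rewrite -scalerAl -scalerAr scalerA -exprD -vv expnS mul2n -addnn; congr (_ - _ *: _).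
  by rewrite exprD rmorphM /= mulrACA.
have E' r g0 : inverse_of (1 - ((r ^+ (2 ^ j))%:C * - v) *: z ^+ (2 ^ j)) g0 ->
    inverse_of (1 + ((r ^+ (2 ^ j))%:C * v) *: z ^+ (2 ^ j)) g0.
  by rewrite mulrN scaleNr opprK.
exists ((2 : R[i])^-1 *: (g + g')), ((2 : R[i])^-1 *: (h + h')); split.
- by rewrite E; apply: inverse_of_half gP _; exact: E'.
- by rewrite E; apply: inverse_of_half hP _; exact: E'.
(* The mean of two differences of norm at most [e] again has norm at most [e]: the bound does not
   deteriorate as [j] grows. *)
rewrite -scalerBr normZ.
have -> : cnorm 2^-1 = 1 / 2.
  have -> : (2 : R[i])^-1 = (2^-1)%:C by rewrite fmorphV /= rmorphMn.
  by rewrite cnorm_real ger0_norm ?invr_ge0 // mul1r.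
have -> : g + g' - (h + h') = (g - h) + (g' - h') by rewrite opprD addrACA.
by have := normD (g - h) (g' - h'); lra.
Qed.

(** For [0 <= s], raising [j] by one at most squares the left side, so a value below [1] leads to
    arbitrarily small ones; [1 / 4] is the bound that the proof of [pow2_small_step] yields. *)
Definition pow2_small z s := exists j, s ^+ (2 ^ j) * N (z ^+ (2 ^ j)) <= 1 / 4.

Lemma pow2_small_lt z s (e : R) : 0 <= s -> 0 < e -> pow2_small z s ->
  exists j, s ^+ (2 ^ j) * N (z ^+ (2 ^ j)) <= e.
Proof.
move=> s0 e0 [j hj].
have h i : s ^+ (2 ^ (j + i)) * N (z ^+ (2 ^ (j + i))) <= 1 / 4 / 2 ^+ i.
  elim: i => [|i IH]; first by rewrite addn0 divr1.
  rewrite addnS expnS mul2n -addnn !exprD.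
  have := normM (z ^+ (2 ^ (j + i))) (z ^+ (2 ^ (j + i))).
  have a0 := norm_ge0 (z ^+ (2 ^ (j + i))); have b0 : 0 <= s ^+ (2 ^ (j + i)).
    exact: exprn_ge0.
  have i1 : (2 ^+ i)^-1 <= 1 :> R by rewrite invf_le1 ?exprn_gt0 // exprn_ege1 // ler1n.
  have i0 : 0 <= (2 ^+ i)^-1 :> R by rewrite invr_ge0 exprn_ge0.
  rewrite exprS invfM; move: IH a0 b0 i1 i0.
  move: (N (_ ^+ (2 ^ (j + i)))) (N (_ * _)) (s ^+ _) ((2 ^+ i)^-1).
  move=> a c b q IH a0 b0 q1 q0 hc.
  apply: le_trans (ler_wpM2l (mulr_ge0 b0 b0) hc) _.
  have : 0 <= b * a by exact: mulr_ge0.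
  have -> : b * b * (a * a) = (b * a) * (b * a) by ring.
  by move: (b * a) IH => w; nra.
have [M hM] := geom_small (1 / 4) e e0.
by exists (j + M)%N; apply: le_trans (h M) _; apply: ltW; exact: hM.
Qed.

(* The resolvents at [s] and [t] stay close after passing to any power [2 ^ j], so if one is
   close to [1] then so is the other. *)
Lemma pow2_small_step z (f : R[i] -> A) s t (M : R) :
  (forall l, inverse_of (1 - l *: z) (f l)) ->
  (forall l, cnorm l <= Num.max s t -> N (f l) <= M) ->
  0 <= s -> 0 <= t -> `|s - t| * (M * N z * M) <= 1 / 10 ->
  pow2_small z s -> pow2_small z t.
Proof.
move=> fP fM s0 t0 he; have n1 := norm1_ge1.
have q0 : 0 < 1 / (20 * N 1) by rewrite divr_gt0 //; lra.
move/(pow2_small_lt z s _ s0 q0) => [j hj]; exists j.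
have c1 : cnorm 1 = 1 by rewrite (cnorm_real 1) normr1.
have [g [h [[g1 _] [_ h2] gh]]] := resolvent_pow2 z f s t M _ fP fM s0 t0 he j 1 c1.
rewrite !mulr1 in g1 h2.
set w := _ *: _ in g1; set w' := _ *: _ in h2.
have Nw : N w <= 1 / (20 * N 1).
  by rewrite normZ cnorm_real ger0_norm ?exprn_ge0.
have Nw' : N w' = t ^+ (2 ^ j) * N (z ^+ (2 ^ j)).
  by rewrite normZ cnorm_real ger0_norm ?exprn_ge0.
have gE : g - 1 = w * g by rewrite -[X in g - X]g1 mulrBl mul1r opprB addrC subrK.
(* From [h (1 - w') = 1]. As [N (h - 1) <= 1 / 5], this gives [N w' <= (1 + N w') / 5], that is
   [N w' <= 1 / 4]. *)
have hE : w' = (h - 1) - (h - 1) * w'.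
  rewrite mulrBr mulr1 in h2.
  by rewrite mulrBl mul1r opprB addrCA addrAC h2 subrr addr0.
have Ng := normD (g - 1) 1; rewrite subrK gE in Ng.
have Nwg := normM w g.
have bw : N w <= 1 / 20.
  apply: le_trans Nw _; rewrite ler_pdivrMr; lra.
have bwN : N w * N 1 <= 1 / 20.
  apply: le_trans (ler_wpM2r _ Nw) _; first by lra.
  by rewrite le_eqVlt; apply/orP; left; apply/eqP; field; lra.
have g1' : N (g - 1) <= 1 / 10.
  rewrite gE; move: (norm_ge0 w) (norm_ge0 g) => w0 g0; nra.
have h1' : N (h - 1) <= 1 / 5.
  have -> : h - 1 = (g - 1) - (g - h) by rewrite opprB [RHS]addrC addrA subrK.
  have := normB (g - 1) (g - h); lra.
rewrite -Nw'; have := normB (h - 1) ((h - 1) * w'); rewrite -hE.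
have := normM (h - 1) w'; have := norm_ge0 w'; nra.
Qed.

(** The disc of radius [r] has a uniform resolvent bound [M], so one step length [d] works
    throughout, and finitely many steps lead from [0] to [r]. *)
Lemma resolvent_pow2_small z (f : R[i] -> A) r :
  (forall l, inverse_of (1 - l *: z) (f l)) -> 0 <= r -> pow2_small z r.
Proof.
move=> fP r0; have [M hM] := resolvent_bounded z f fP r.
have K0 : 0 <= M * N z * M by rewrite mulrAC mulr_ge0 ?norm_ge0 // -expr2 sqr_ge0.
pose d : R := 1 / (10 * (M * N z * M + 1)).
have d0 : 0 < d by rewrite divr_gt0 //; lra.
have dK : d * (M * N z * M) <= 1 / 10.
  rewrite /d; move: (M * _ * _) K0 => k k0.
  by rewrite mulrAC mul1r ler_pdivrMr; lra.
have h n : pow2_small z (Num.min r (n%:R * d)).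
  elim: n => [|n IH].
    by exists 0%N; rewrite mul0r min_r // expr1 mul0r; lra.
  have n0 : 0 <= n%:R * d by rewrite mulr_ge0 // ltW.
  have n1 : n.+1%:R * d = n%:R * d + d by rewrite -natr1 mulrDl mul1r.
  apply: (pow2_small_step z f _ _ M fP _ _ _ _ IH).
  - move=> l hl; apply: hM; apply: le_trans hl _.
    by rewrite ge_max !ge_min lexx.
  - by rewrite le_min r0.
  - by rewrite le_min r0 n1 addr_ge0 // ltW.
  apply: le_trans _ dK; apply: ler_wpM2r => //; rewrite n1.
  move: (n%:R * d) => a; rewrite ler_norml.
  by case: (leP r a) => h1; case: (leP r (a + d)) => h2; apply/andP; split; lra.
have := h (Num.bound (r / d)); rewrite min_l //.
rewrite -ler_pdivrMr // ltW // archi_boundP //.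
by rewrite divr_ge0 // ltW.
Qed.

Lemma pow2_small_tnil z : (forall r, 0 <= r -> pow2_small z r) -> tnil z.
Proof.
move=> h; apply: norm_tnil => e e0.
have [j hj] := h e^-1 ltac:(by rewrite invr_ge0 ltW).
set k := (2 ^ j)%N in hj; have k0 : (0 < k)%N by rewrite expn_gt0.
have hk : N (z ^+ k) <= e ^+ k.
  move: hj; rewrite exprVn mulrC ler_pdivrMr ?exprn_gt0 //.
  have : 0 < e ^+ k by rewrite exprn_gt0.
  by lra.
(* Dividing [n] by [k] leaves a remainder [i < k], whose contribution [N (z ^+ i) / e ^+ i] is one
   of the terms of this sum. *)
exists (\sum_(i < k) N (z ^+ i) / e ^+ i) => n.
rewrite (divn_eq n k) exprD mulnC exprM; apply: le_trans (normX_mul _ _ _) _.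
rewrite exprD exprM mulrCA; apply: ler_pM; rewrite ?exprn_ge0 ?norm_ge0 //.
  apply: lerXn2r hk; rewrite nnegrE ?norm_ge0 //.
  by rewrite exprn_ge0 // ltW.
rewrite -ler_pdivrMr ?exprn_gt0 //.
rewrite (bigD1 (Ordinal (ltn_pmod n k0))) //= lerDl; apply: sumr_ge0 => i _.
by rewrite divr_ge0 ?norm_ge0 // exprn_ge0 // ltW.
Qed.

Lemma quasinilpotent_tnil z : quasinilpotent z -> tnil z.
Proof.
move=> qz; apply: pow2_small_tnil => r r0.
have /choice [f fP] : forall l, exists y, inverse_of (1 - l *: z) y.
  move=> l; have [->|l0] := eqVneq l 0.
    by exists 1; rewrite scale0r subr0 /inverse_of mulr1.
  have [y [y1 y2]] : invertible (l^-1%:A - z).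
    apply: contrapT => nl.
    have : (spectrum z) l^-1 by [].
    by rewrite qz /= => /eqP; rewrite invr_eq0 (negbTE l0).
  exists (l^-1 *: y); have -> : 1 - l *: z = l *: (l^-1%:A - z).
    by rewrite scalerBr scalerA divff // scale1r.
  by rewrite /inverse_of -!scalerAl -!scalerAr !scalerA mulVf // divff // y1 y2 !scale1r.
exact: resolvent_pow2_small fP r0.
Qed.

(** * Generalized pi-Hirano inverses and almost commuting pairs *)

(** With [p = a x] and [w] the quasinilpotent defect [a - a ^+ m.+2 p], the factor [1 - p] kills the
    second term of [w], so [a - a a x = (1 - p) w]; then [a - a ^+ m.+2 = w - a ^+ m.+1 (a - a a
    x)]. *)
Lemma gpiH_tnil a x : is_gpiH_inverse a x ->
  tnil (a - a * a * x) /\ exists m, tnil (a - a ^+ m.+2).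
Proof.
move=> [xax ax [[|m] [// _ /quasinilpotent_tnil]]].
have [p pE] : exists p, p = a * x by exists (a * x).
have pp : p * p = p by rewrite pE -mulrA (mulrA x) xax.
have ap : a * p = p * a by rewrite pE {1}ax mulrA.
have [w wE] : exists w, w = a - a ^+ m.+2 * p by exists (a - a ^+ m.+2 * p).
rewrite exprSr -mulrA -pE -wE => tw.
have pa n : a ^+ n * p = p * a ^+ n by apply/esym/commrX/esym.
have aXa n : a * a ^+ n = a ^+ n * a by rewrite -exprS -exprSr.
have aw : a * w = w * a.
  rewrite wE mulrBr mulrBl; congr (_ - _).
  by rewrite -[RHS]mulrA -ap (mulrA a (a ^+ m.+2) p) aXa -[LHS]mulrA.
have pw : p * w = w * p.
  rewrite wE mulrBr mulrBl ap; congr (_ - _).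
  by rewrite (mulrA p) -(pa m.+2).
have rw : (1 - p) * w = w * (1 - p) by rewrite [LHS]mulrBl [RHS]mulrBr mul1r mulr1 pw.
have qE : a - a * a * x = (1 - p) * w.
  rewrite -mulrA -pE rw [RHS]mulrBr mulr1 {2}wE mulrBl -(mulrA _ p p) pp wE.
  by rewrite opprB addrA subrK.
have tq : tnil (a - a * a * x) by rewrite qE; exact: tnilM.
split=> //; exists m.
have -> : a - a ^+ m.+2 = w + - a ^+ m.+1 * (a - a * a * x).
  rewrite -(mulrA a a x) -pE wE mulNr mulrBr (mulrA _ a p) -exprSr.
  by rewrite opprB addrA subrK.
apply: tnilD => //; last first.
  apply: tnilM => //; rewrite qE rw mulNr mulrN; congr (- _).
  have aX : a ^+ m.+1 * w = w * a ^+ m.+1 by apply/esym/commrX/esym.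
  rewrite mulrA aX -mulrA -[RHS]mulrA; congr (w * _).
  by rewrite [LHS]mulrBr [RHS]mulrBl mulr1 mul1r pa.
have aX : a ^+ m.+1 * w = w * a ^+ m.+1 by apply/esym/commrX/esym.
rewrite qE mulNr mulrN mulNr; congr (- _).
by rewrite rw !mulrA aX -[RHS]mulrA rw !mulrA.
Qed.

(** Whatever the growth of [g ^+ n], testing [q] at [1 / (2 (N g + 1))] leaves a bound of order
    [1 / 2 ^+ n] on [N x]. *)
Lemma tnil_eq0l q d g v x : tnil q ->
  (forall n, x = q ^+ n * (d * (g ^+ n * v))) -> x = 0.
Proof.
move=> tq xE; have g0 := norm_ge0 g.
have [|C C0 hC] := tnil_norm q (1 / (2 * (N g + 1))) tq.
  by rewrite divr_gt0 //; lra.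
apply: (norm_geom_eq0 _ (C * (N d * N v))) => n; rewrite (xE n).
apply: le_trans (normM _ _) _.
have : N (d * (g ^+ n * v)) <= N d * N v * (N g + 1) ^+ n.
  apply: le_trans (normM _ _) _; rewrite -mulrA ler_wpM2l ?norm_ge0 //.
  apply: le_trans (normX_mul _ _ _) _; rewrite mulrC ler_wpM2l ?norm_ge0 //.
  by apply: lerXn2r; rewrite ?nnegrE; lra.
move=> h; apply: le_trans (ler_pM (norm_ge0 _) (norm_ge0 _) (hC n) h) _.
rewrite le_eqVlt; apply/orP; left; apply/eqP.
rewrite expr_div_n expr1n exprMn; field.
by rewrite !expf_neq0 //; lra.
Qed.

Lemma tnil_eq0r q d g v x : tnil q ->
  (forall n, x = g ^+ n * (d * (q ^+ n * v))) -> x = 0.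
Proof.
move=> tq xE; have g0 := norm_ge0 g.
have [|C C0 hC] := tnil_norm q (1 / (2 * (N g + 1))) tq.
  by rewrite divr_gt0 //; lra.
apply: (norm_geom_eq0 _ (C * (N d * N v))) => n; rewrite (xE n).
apply: le_trans (normX_mul _ _ _) _.
have : N (d * (q ^+ n * v)) <= N d * N v * (C * (1 / (2 * (N g + 1))) ^+ n).
  apply: le_trans (normM _ _) _; rewrite -mulrA ler_wpM2l ?norm_ge0 //.
  apply: le_trans (normM _ _) _; rewrite mulrC ler_wpM2l ?norm_ge0 //.
have h : N g ^+ n <= (N g + 1) ^+ n by apply: lerXn2r; rewrite ?nnegrE; lra.
move=> h'; apply: le_trans (ler_pM (exprn_ge0 _ g0) (norm_ge0 _) h h') _.
rewrite le_eqVlt; apply/orP; left; apply/eqP.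
rewrite expr_div_n expr1n exprMn; field.
by rewrite !expf_neq0 //; lra.
Qed.

(* On [X], write [p = a g] and [q = a (1 - p)]: the off-diagonal blocks satisfy
   [(1-p) b p = q^n ((1-p) b p) g^n] and [p b (1-p) = g^n (p b (1-p)) q^n],
   so both vanish since [q] is topologically nilpotent. *)
Lemma gpiH_inverse_comm_on X a b g : add_closed X -> stable X (-1) ->
  stable X a -> stable X b -> stable X g -> comm_on X a b ->
  a * g = g * a -> g * a * g = g -> tnil (a - a * a * g) -> comm_on X g b.
Proof.
move=> aX nX sa sb sg cab ag gag tq y Xy.
set q := a - _ in tq; pose p := a * g; pose r := 1 - p.
have sr : stable X r.
  by move=> v Xv; rewrite mulrBl mul1r -mulN1r -!mulrA; apply/aX/nX/sa/sg.
have pp : p * p = p by rewrite /p -mulrA (mulrA g) gag.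
have gp : g * p = g by rewrite /p mulrA gag.
have pg : p * g = g by rewrite /p ag gag.
have rr : r * r = r by rewrite [LHS]mulrBl mul1r mulrBr mulr1 pp subrr subr0.
have ar : a * r = q by rewrite mulrBr mulr1 /p mulrA.
have ra : r * a = q by rewrite -ar mulrBr mulrBl mulr1 mul1r /p -mulrA -ag.
have qr : q * r = q by rewrite -ar -mulrA rr.
have rq : r * q = q by rewrite -ra mulrA rr.
have sq : stable X q by move=> v Xv; rewrite -ar -mulrA; apply/sa/sr.
have ab v : X v -> a * (b * v) = b * (a * v) by exact: cab.
have h1 v : X v -> r * (b * (p * v)) = 0.
  move=> Xv; apply: (tnil_eq0l q (r * b * p) g v _ tq) => n.
  elim: n v Xv => [|n IH] v Xv; first by rewrite !expr0 !mul1r -!mulrA.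
  have step : r * (b * (p * v)) = q * (r * (b * (p * (g * v)))).
    rewrite (mulrA p g v) pg (mulrA q r) qr -ra -(mulrA r a) ab; last exact: sg.
    by rewrite (mulrA a g v).
  rewrite step IH; last exact: sg.
  by rewrite (mulrA q) -exprS (exprSr g) -(mulrA (g ^+ n)).
have h2 v : X v -> p * (b * (r * v)) = 0.
  move=> Xv; apply: (tnil_eq0r q (p * b * r) g v _ tq) => n.
  elim: n v Xv => [|n IH] v Xv; first by rewrite !expr0 !mul1r -!mulrA.
  have step : p * (b * (r * v)) = g * (p * (b * (r * (q * v)))).
    rewrite (mulrA r q v) rq (mulrA g p) gp -ar -(mulrA a r v) -ab; last exact: sr.
    by rewrite (mulrA g a) -ag.
  rewrite step IH; last exact: sq.
  by rewrite (mulrA g) -exprS (exprSr q) -(mulrA (q ^+ n)).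
have pb v : X v -> p * (b * v) = b * (p * v).
  move=> Xv; have Xp : X (p * v) by rewrite -mulrA; apply/sa/sg.
  have := h1 v Xv; have := h2 v Xv; rewrite /r !mulrBl !mul1r !mulrBr.
  by move=> /eqP; rewrite subr_eq0 => /eqP -> /eqP; rewrite subr_eq0 => /eqP <-.
(* The chain is [g b y = g p b y = g b p y = g b a g y = g a b g y = p b g y = b p g y = b g y]. *)
rewrite -{1}gp -mulrA pb // -(mulrA a g y) -ab; last exact: sg.
rewrite (mulrA g a) -ag pb; last exact: sg.
by rewrite (mulrA p) pg.
Qed.

Lemma norm_shift_tnil z j (e C : R) : 0 < e -> 0 <= C ->
  (forall n, N (z ^+ (n + j)) <= C * e ^+ n) -> exists C' : R, forall n, N (z ^+ n) <= C' * e ^+ n.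
Proof.
move=> e0; elim: j C => [|j IH] C C0 h.
  by exists C => n; have := h n; rewrite addn0.
have Ce : 0 <= C / e by rewrite divr_ge0 // ltW.
apply: (IH (C / e + N (z ^+ j))); first by rewrite addr_ge0 ?norm_ge0.
move=> [|n]; first by rewrite expr0 mulr1 add0n lerDr.
rewrite addSnnS; apply: le_trans (h n) _; rewrite mulrDl exprS mulrA divfK ?gt_eqF //.
by rewrite lerDl mulr_ge0 ?norm_ge0 // mulr_ge0 ?exprn_ge0 // ltW.
Qed.

(** Taking [v = z ^+ j] turns the estimate on [X] into one on [N (z ^+ (n + j))], and shifting the
    exponent only changes the constant. *)
Lemma tnil_on_tnil X z j : X (z ^+ j) -> tnil_on X z -> tnil z.
Proof.
move=> Xz tz; apply: norm_tnil => e e0; have [C C0 h] := tz e e0.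
apply: (norm_shift_tnil z j e (C * N (z ^+ j))); rewrite ?mulr_ge0 ?norm_ge0 //.
by move=> n; rewrite exprD mulrAC; exact: h.
Qed.

(** An inductive closure, so that stability of [X] and commutation on [X] pass by induction from the
    three generators to all elements. *)
Inductive generated (a b c : A) : A -> Prop :=
| generated_fst : generated a b c a
| generated_snd : generated a b c b
| generated_trd : generated a b c c
| generated1 : generated a b c 1
| generatedD x y : generated a b c x -> generated a b c y -> generated a b c (x + y)
| generatedN x : generated a b c x -> generated a b c (- x)
| generatedM x y : generated a b c x -> generated a b c y -> generated a b c (x * y).

Lemma generated_stable X a b c x : add_closed X -> stable X (-1) ->
  stable X a -> stable X b -> stable X c -> generated a b c x -> stable X x.
Proof.
move=> aX nX sa sb sc; elim=> //.
- by move=> v; rewrite mul1r.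
- by move=> y z _ sy _ sz; exact: stableD.
- by move=> y _ sy v Xv; rewrite -mulN1r -mulrA; apply/nX/sy.
- by move=> y z _ sy _ sz v Xv; rewrite -mulrA; apply/sy/sz.
Qed.

Lemma generated_comm_on1 X a b c x y : add_closed X -> stable X (-1) ->
  stable X a -> stable X b -> stable X c -> stable X y ->
  comm_on X a y -> comm_on X b y -> comm_on X c y -> generated a b c x -> comm_on X x y.
Proof.
move=> aX nX sa sb sc sy ca cb cc; elim=> //.
- by move=> v; rewrite !mul1r.
- by move=> u w _ cu _ cw v Xv; rewrite !mulrDl mulrDr cu ?cw.
- by move=> u _ cu v Xv; rewrite !mulNr mulrN cu.
- move=> u w _ cu gw cw v Xv; rewrite -!mulrA cw // cu //.
  by apply: (generated_stable X a b c w).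
Qed.

Lemma generated_comm_on X a b c x y : add_closed X -> stable X (-1) ->
  stable X a -> stable X b -> stable X c ->
  comm_on X a b -> comm_on X a c -> comm_on X b c ->
  generated a b c x -> generated a b c y -> comm_on X x y.
Proof.
move=> aX nX sa sb sc ab ac bc gx gy.
have sym u w : comm_on X u w -> comm_on X w u by move=> h v Xv; rewrite h.
have refl u : comm_on X u u by [].
have h z : stable X z -> comm_on X a z -> comm_on X b z -> comm_on X c z -> comm_on X y z.
  by move=> sz az bz cz; apply: (generated_comm_on1 X a b c).
apply: (generated_comm_on1 X a b c) => //; try exact: (generated_stable X a b c).
- by apply/sym/h => //; exact: sym.
- by apply/sym/h => //; exact: sym.
- by apply/sym/h => //; exact: sym.
Qed.

(** * The right ideal killed by the commutator behind every word *)

Section CommutingPastWords.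
Variables (k : nat) (a b : A).
Hypothesis comm_words : forall alpha : 'I_k -> A, (forall i, alpha i = a \/ alpha i = b) ->
  a * b * (\prod_(i < k) alpha i) = b * a * (\prod_(i < k) alpha i).

Definition word (l : seq bool) : A := \prod_(i <- l) (if i then a else b).

(** The word between the commutator and [v] makes this right ideal stable under left multiplication
    by [a] and [b]. *)
Definition comm_annihilated v := forall l, (a * b - b * a) * word l * v = 0.
Local Notation X := comm_annihilated.

Lemma word_long l : (k <= size l)%N -> (a * b - b * a) * word l = 0.
Proof.
move=> kl; rewrite /word -(cat_take_drop k l) big_cat /= mulrA.
have sk : size (take k l) = k by rewrite size_takel.
rewrite (big_nth true) sk big_mkord mulrBl comm_words ?subrr ?mul0r // => i.
by case: nth; [left | right].
Qed.

Lemma annihilatedD : add_closed X.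
Proof. by move=> u v hu hv l; rewrite mulrDr hu hv addr0. Qed.

Lemma annihilatedMr u v : X u -> X (u * v).
Proof. by move=> hu l; rewrite mulrA hu mul0r. Qed.

Lemma annihilatedN1 : stable X (-1).
Proof. by move=> v hv l; rewrite mulN1r mulrN hv oppr0. Qed.

Lemma annihilated_letter (i : bool) : stable X (if i then a else b).
Proof.
move=> v hv l; have := hv (rcons l i).
by rewrite /word -cats1 big_cat big_seq1 /= !mulrA.
Qed.

Lemma annihilated_comm : comm_on X a b.
Proof.
move=> v /(_ [::]); rewrite /word big_nil mulr1 mulrBl !mulrA.
by move/eqP; rewrite subr_eq0 => /eqP.
Qed.

(** Each factor [a + b] appends one letter to the word in front of it, so after [k] factors the word
    is long enough for [word_long]. *)
Lemma annihilated_expr : X ((a + b) ^+ k).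
Proof.
suff h j v : (forall l, (j <= size l)%N -> (a * b - b * a) * word l * v = 0) ->
    X ((a + b) ^+ j * v).
  by rewrite -[_ ^+ k]mulr1; apply: h => l /word_long ->; rewrite mul0r.
elim: j v => [|j IH] v hv; first by rewrite expr0 mul1r => l; exact: hv.
rewrite exprSr -mulrA; apply: IH => l jl; rewrite [(a + b) * v]mulrDl mulrDr.
have h i : (a * b - b * a) * word l * ((if i then a else b) * v) = 0.
  have := hv (rcons l i); rewrite size_rcons ltnS => /(_ jl).
  by rewrite /word -cats1 big_cat big_seq1 /= !mulrA.
by have := h true; have := h false => /= -> ->; rewrite addr0.
Qed.

(** Here [g = a ^+ k g ^+ k.+1], and [a ^+ k] makes every word in front of it long. *)
Lemma annihilated_group_inverse g : a * g = g * a -> g * a * g = g -> X g.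
Proof.
move=> ag gag l.
have gE n : a ^+ n * g ^+ n.+1 = g.
  elim: n => [|n IH]; first by rewrite expr0 mul1r expr1.
  rewrite exprSr -mulrA (exprS g) (exprS g) (mulrA a g) (mulrA (a * g)) ag gag.
  by rewrite -exprS.
have wE : word (l ++ nseq k true) = word l * a ^+ k.
  rewrite /word big_cat /=; congr (_ * _).
  by elim: (k) => [|n IH]; rewrite ?big_nil // big_cons IH exprS.
rewrite -(gE k) mulrA -[_ * _ * a ^+ k]mulrA -wE word_long ?mul0r //.
by rewrite size_cat size_nseq leq_addl.
Qed.

Lemma gpiH_invertibleD_iff g : is_gpiH_inverse a g -> gpiH_invertible b ->
  gpiH_invertible (1 + g * b) <-> gpiH_invertible (a + b).
Proof.
move=> ag_inv [g' /gpiH_tnil [_ [l tb]]].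
have [tq [m ta]] := gpiH_tnil _ _ ag_inv; have [gag ag _] := ag_inv.
have aX := annihilatedD; have nX := annihilatedN1.
have sa : stable X a := annihilated_letter true.
have sb : stable X b := annihilated_letter false.
have Xg : X g by exact: annihilated_group_inverse.
have sg : stable X g by move=> v _; exact: annihilatedMr.
have cab := annihilated_comm.
have cgb : comm_on X g b by exact: (gpiH_inverse_comm_on X a b g).
have cag : comm_on X a g by move=> v _; rewrite !mulrA ag.
pose S := generated a b g; pose J := tnil_on X.
have st x : S x -> stable X x by exact: generated_stable.
have cS x y : S x -> S y -> comm_on X x y.
  by apply: (generated_comm_on X a b g) => // v Xv; rewrite cgb.
have S1 : S 1 by exact: generated1.
have SD x y : S x -> S y -> S (x + y) by exact: generatedD.
have SN x : S x -> S (- x) by exact: generatedN.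
have SM x y : S x -> S y -> S (x * y) by exact: generatedM.
have Sa : S a by exact: generated_fst.
have Sb : S b by exact: generated_snd.
have Sg : S g by exact: generated_trd.
have JD x y : S x -> S y -> J x -> J y -> J (x + y).
  by move=> Sx Sy; apply: tnil_onD; [exact: aX | exact: st | exact: st | exact: cS].
have JM x y : S x -> S y -> J y -> J (x * y).
  by move=> Sx Sy; apply: tnil_onM; [exact: st | exact: st | exact: cS].
have J0' x : (forall v, X v -> x * v = 0) -> J x.
  move=> x0; apply: (tnil_on_eq X 0); last exact: tnil_on0.
    by move=> v Xv w; rewrite mul0r mulr0.
  by move=> v Xv; rewrite x0 // mul0r.
have JC x y : S x -> S y -> J (x * y - y * x).
  by move=> Sx Sy; apply: J0' => v Xv; rewrite mulrBl -!mulrA cS // subrr.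
have SXn x n : S x -> S (x ^+ n) by exact: closedX.
have pot z n : S z -> tnil (z - z ^+ n.+2) -> potent A S J z.
  move=> Sz tz; exists n; split=> //; first exact: SXn.
  by apply: tnil_tnil_on; rewrite -opprB; exact: tnilN.
(* Potency modulo [J] gives topological nilpotency of [z ^+ n.+2 - z] only on [X]; a power of this
   element lying in [X] extends it to the whole algebra. *)
have inv z : S z -> (forall n, exists j, X ((z ^+ n.+2 - z) ^+ j)) ->
    gpiH_invertible z <-> potent A S J z.
  move=> Sz Xz; split=> [[z' /gpiH_tnil [_ [n tz]]]|[n [_ _ tz]]]; first exact: (pot z n).
  have [j Xj] := Xz n; apply: (tnil_gpiH z n).
  by rewrite -opprB; apply/tnilN/(tnil_on_tnil X _ j).
have Sz : S (1 + g * b) by apply: SD => //; exact: SM.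
have Ss : S (a + b) by exact: SD.
rewrite (inv (1 + g * b)) // ?(inv (a + b)) //.
- apply: (potentD_group_inverse A S J) => //; try exact: (pot _ _ _ ta); try exact: (pot _ _ _ tb).
  + exact: tnil_on0.
  + split=> //; first exact: (SM _ _ (SM _ _ Sa Sa) Sg).
    by apply: tnil_tnil_on; rewrite -opprB; exact: tnilN.
  + split=> //; first exact: (SM _ _ (SM _ _ Sg Sg) Sa).
    by rewrite -mulrA -ag mulrA gag subrr; exact: tnil_on0.
(* The factor [s] commutes with [s ^+ n.+1 - 1], so the [k]-th power of the product starts with
   [s ^+ k], which lies in the right ideal [X]. *)
- move=> n; exists k; set s := a + b.
  have -> : s ^+ n.+2 - s = s * (s ^+ n.+1 - 1) by rewrite mulrBr mulr1 -exprS.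
  rewrite exprMn_comm; first by apply: annihilatedMr; exact: annihilated_expr.
  by rewrite /GRing.comm mulrBr mulrBl mulr1 mul1r -exprS -exprSr.
- move=> n; exists 1%N; rewrite expr1; set z := 1 + g * b.
  have sz : stable X z by apply: st; apply: SD => //; exact: SM.
  (* The difference [z - 1 = g b] lies in [X] because [g] does, hence so does every [z ^+ i - 1],
     and exponent [1] suffices. *)
  have h i : X (z ^+ i - 1).
    elim: i => [|i IH]; first by rewrite expr0 subrr => w; rewrite mulr0.
    have -> : z ^+ i.+1 - 1 = z * (z ^+ i - 1) + g * b.
      by rewrite mulrBr mulr1 -exprS /z [1 + _]addrC opprD addrA addrAC subrK.
    by apply: aX; [exact: sz | exact: annihilatedMr].
  have -> : z ^+ n.+2 - z = z * (z ^+ n.+1 - 1) by rewrite mulrBr mulr1 -exprS.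
  exact: sz.
Qed.

End CommutingPastWords.
End BanachAlgebra.

Theorem theorem3p11 (R : realType) (A : algType R[i]) (N : A -> R)
  (HN : banach_algebra_norm N) (k : nat) (a b ai : A) :
  (0 < k)%N ->
  is_gpiH_inverse a ai ->
  gpiH_invertible b ->
  (forall alpha : 'I_k -> A, (forall i, alpha i = a \/ alpha i = b) ->
     a * b * (\prod_(i < k) alpha i) = b * a * (\prod_(i < k) alpha i)) ->
  (gpiH_invertible (1 + ai * b) <-> gpiH_invertible (a + b)).
Proof.
by move=> _ hai hb comm_words; apply: (gpiH_invertibleD_iff N HN k).
Qed.
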